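(* Let $n \ge 1$ and let $\mathbf{C}(\mathbb{R}^n)$ be the set of non-empty compact subsets of $\mathbb{R}^n$, equipped with the Hausdorff distance $d_H$. There is no convexity measure $m$ on $\mathbf{C}(\mathbb{R}^n)$ which is both continuous for the Hausdorff distance and invariant by translations and homotheties. That is, there is no function $m : \mathbf{C}(\mathbb{R}^n) \to \mathbb{R}$ satisfying all of the following: (1) $m(A) \in [0,1]$ for all $A \in \mathbf{C}(\mathbb{R}^n)$; (2) for all $A \in \mathbf{C}(\mathbb{R}^n)$, $m(A) = 1$ if and only if $A$ is convex; (3) there exists a sequence $(A_k)_{k}$ in $\mathbf{C}(\mathbb{R}^n)$ such that $m(A_k) \to 0$ as $k \to \infty$; (4) $m$ is continuous with respect to $d_H$; (5) $m(h(A)) = m(A)$ for every $A \in \mathbf{C}(\mathbb{R}^n)$ and every map $h : \mathbb{R}^n \to \mathbb{R}^n$ that is a translation or a homothety.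
   Context: For $A, B \in \mathbf{C}(\mathbb{R}^n)$, the Hausdorff distance is $d_H(A,B) = \max\{\sup_{a \in A} d(a,B),\ \sup_{b \in B} d(b,A)\}$, where $d$ is the Euclidean distance and $d(x,S) = \inf_{s \in S} d(x,s)$. A homothety is a map $x \mapsto c + \lambda (x - c)$ with $c \in \mathbb{R}^n$ and $\lambda \in \mathbb{R}$, $\lambda \ne 0$. *)

(* Defs.v *)
From HB Require Import structures.
From mathcomp Require Import all_boot all_order all_algebra.
From mathcomp Require Import all_classical all_reals all_analysis.
Import Order.TTheory GRing.Theory Num.Theory.
Import numFieldNormedType.Exports.
Set Implicit Arguments.
Unset Strict Implicit.
Unset Printing Implicit Defensive.
Local Open Scope classical_set_scope.
Local Open Scope ring_scope.

(* The library norm on ['rV[R]_n] is the sup norm, so the Euclidean distance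
   is defined here; both induce the product topology, which is the one used
   by [compact] and [continuous]. *)
Definition eucl_dist (R : realType) (n : nat) (x y : 'rV[R]_n) : R :=
  Num.sqrt (\sum_(i < n) (x ord0 i - y ord0 i) ^+ 2).

Definition dist_to_set (R : realType) (n : nat) (x : 'rV[R]_n)
    (S : set 'rV[R]_n) : R :=
  inf [set eucl_dist x s | s in S].

Record nonempty_compact (R : realType) (n : nat) : Type := NonemptyCompact {
  nc_set :> set 'rV[R]_n;
  nc_nonempty : nc_set !=set0;
  nc_compact : compact nc_set
}.

(* [sup] and [inf] are the real-valued ones, with junk value 0 on sets that
   are empty or unbounded; neither occurs for non-empty compact sets. *)
Definition hausdorff_dist (R : realType) (n : nat)
    (A B : nonempty_compact R n) : R :=
  Num.max (sup [set dist_to_set a B | a in A])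
          (sup [set dist_to_set b A | b in B]).

Definition is_translation (R : realType) (n : nat)
    (h : 'rV[R]_n -> 'rV[R]_n) : Prop :=
  exists v : 'rV[R]_n, forall x, h x = x + v.

Definition is_homothety (R : realType) (n : nat)
    (h : 'rV[R]_n -> 'rV[R]_n) : Prop :=
  exists (c : 'rV[R]_n) (l : R),
    l != 0 /\ forall x, h x = c + l *: (x - c).

Lemma add_scale_sub_continuous (R : realType) (V : normedModType R)
    (l : R) (c v : V) : continuous (fun x : V => v + l *: (x - c)).
Proof.
move=> x; apply: cvgD; first exact: cvg_cst.
by apply: cvgZl_tmp; apply: cvgB; [exact: cvg_id|exact: cvg_cst].
Qed.

Lemma translation_homothety_continuous (R : realType) (n : nat)
    (h : 'rV[R]_n -> 'rV[R]_n) :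
  is_translation h \/ is_homothety h -> continuous h.
Proof.
move=> [[v hE]|[c [l [_ hE]]]].
  have -> : h = fun x => v + 1 *: (x - 0).
    by apply/funext => x; rewrite hE scale1r subr0 addrC.
  exact: (@add_scale_sub_continuous R 'rV[R]_n).
have -> : h = fun x => c + l *: (x - c) by exact/funext.
exact: (@add_scale_sub_continuous R 'rV[R]_n).
Qed.

Lemma image_compact_of_continuous (R : realType) (n : nat)
    (h : 'rV[R]_n -> 'rV[R]_n) (A : set 'rV[R]_n) :
  continuous h -> compact A -> compact (h @` A).
Proof.
by move=> hc; apply: continuous_compact; exact: continuous_subspaceT.
Qed.

Definition nc_image (R : realType) (n : nat) (h : 'rV[R]_n -> 'rV[R]_n)
    (hh : is_translation h \/ is_homothety h) (A : nonempty_compact R n) :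
    nonempty_compact R n :=
  @NonemptyCompact R n (h @` A)
    (image_nonempty h (nc_nonempty A))
    (image_compact_of_continuous (translation_homothety_continuous hh)
       (@nc_compact R n A)).

Definition convexity_measure (R : realType) (n : nat)
    (m : nonempty_compact R n -> R) : Prop :=
  [/\ forall A, 0 <= m A <= 1,
      forall A, m A = 1 <-> convex_set (nc_set A)
    & exists A_ : nat -> nonempty_compact R n,
        (fun k => m (A_ k)) @ \oo --> (0 : R)].

Definition hausdorff_continuous (R : realType) (n : nat)
    (m : nonempty_compact R n -> R) : Prop :=
  forall A (e : R), 0 < e -> exists2 d : R, 0 < d &
    forall B, hausdorff_dist A B < d -> `|m B - m A| < e.

Definition translation_homothety_invariant (R : realType) (n : nat)
    (m : nonempty_compact R n -> R) : Prop :=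
  forall (A : nonempty_compact R n) (h : 'rV[R]_n -> 'rV[R]_n)
    (hh : is_translation h \/ is_homothety h), m (nc_image hh A) = m A.

(* Main.v *)
Require Import Defs.
From mathcomp Require Import all_boot all_order all_algebra.
From mathcomp Require Import all_classical all_reals all_analysis.

(** A homothety of small ratio shrinks a compact set [A] towards its centre
    without changing the value of an invariant [m]: the sets [l *: A] with
    [l] tending to [0] all have measure [m A], yet they converge to the
    singleton [{0}] for the Hausdorff distance ([exists_close_rescaling]).
    Hence continuity at [{0}] forces [m A = m {0}], so [m] is constant
    ([invariant_continuous_eq]).  Since [{0}] is convex the constant is [1],
    and no sequence of values of [m] can tend to [0]. *)

Import Order.TTheory GRing.Theory Num.Theory.
Import numFieldNormedType.Exports.
Set Implicit Arguments.
Unset Strict Implicit.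
Unset Printing Implicit Defensive.

Section Rescaling.
Local Open Scope classical_set_scope.
Local Open Scope ring_scope.

Context (R : realType) (n : nat).
Implicit Types (A B : nonempty_compact R n) (x y : 'rV[R]_n).

Lemma eucl_distC x y : eucl_dist x y = eucl_dist y x.
Proof.
by congr Num.sqrt; apply: eq_bigr => i _; rewrite -sqrrN opprB.
Qed.

Lemma eucl_dist0Z (l : R) x : eucl_dist 0 (l *: x) = `|l| * eucl_dist 0 x.
Proof.
rewrite /eucl_dist -sqrtr_sqr -sqrtrM ?sqr_ge0// mulr_sumr.
by congr Num.sqrt; apply: eq_bigr => i _; rewrite !mxE !sub0r !sqrrN exprMn.
Qed.

Lemma eucl_dist0_le_norm x : eucl_dist 0 x <= Num.sqrt (\sum_(i < n) `|x| ^+ 2).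
Proof.
rewrite ler_wsqrtr// ler_sum// => i _; rewrite mxE sub0r sqrrN -real_normK ?num_real//.
rewrite lerXn2r ?nnegrE// [leRHS]mx_normrE.
exact: (le_bigmax _ (fun ij => `|x ij.1 ij.2|) (ord0, i)).
Qed.

Lemma dist_to_set_le (S : set 'rV[R]_n) x y :
  S y -> dist_to_set x S <= eucl_dist x y.
Proof.
move=> Sy; apply: ge_inf; last by exists y.
by exists 0 => _ [z _ <-]; exact: sqrtr_ge0.
Qed.

(** A crude bound: it suffices near a singleton, where the largest distance
    between points of the two sets is the Hausdorff distance itself. *)
Lemma hausdorff_dist_le A B (r : R) :
  (forall a b, nc_set A a -> nc_set B b -> eucl_dist a b <= r) ->
  hausdorff_dist A B <= r.
Proof.
move=> ABr; have [a Aa] := nc_nonempty A; have [b Bb] := nc_nonempty B.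
rewrite ge_max; apply/andP; split; apply: ge_sup.
- by exists (dist_to_set a B), a.
- by move=> _ [x Ax <-]; exact: le_trans (dist_to_set_le x Bb) (ABr _ _ _ _).
- by exists (dist_to_set b A), b.
- move=> _ [x Bx <-]; apply: le_trans (dist_to_set_le x Aa) _.
  by rewrite eucl_distC; exact: ABr.
Qed.

Definition nc_origin : nonempty_compact R n :=
  @NonemptyCompact R n [set 0] (ex_intro _ 0 erefl)
    (@compact_set1 'rV[R]_n 0).

Lemma convex_set1 x : convex_set [set x].
Proof. by move=> y z l /set_mem -> /set_mem ->; rewrite convmm inE. Qed.

Lemma nc_eucl_bounded A :
  exists2 K : R, 0 <= K & forall a, nc_set A a -> eucl_dist 0 a <= K.
Proof.
have [M [_ AM]] := compact_bounded (@nc_compact _ _ A).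
exists (Num.sqrt (\sum_(i < n) (`|M| + 1) ^+ 2)); first exact: sqrtr_ge0.
move=> a Aa; apply: le_trans (eucl_dist0_le_norm a) _.
rewrite ler_wsqrtr// ler_sum// => i _; rewrite lerXn2r ?nnegrE ?addr_ge0//.
by apply: AM Aa; rewrite ltr_pwDr// ler_norm.
Qed.

Lemma exists_close_rescaling A (d : R) : 0 < d ->
  exists (h : 'rV[R]_n -> 'rV[R]_n) (hh : is_translation h \/ is_homothety h),
    hausdorff_dist nc_origin (nc_image hh A) < d.
Proof.
move=> d0; have [K K0 AK] := nc_eucl_bounded A.
have K1 : 0 < K + 1 by rewrite ltr_wpDl.
(* The image lies in the ball of radius l * K, and l * K < l * (K + 1) = d. *)
pose l := d / (K + 1); have l0 : 0 < l by rewrite divr_gt0.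
have hh : is_translation (fun x => l *: x) \/ is_homothety (fun x => l *: x).
  right; exists 0, l; split; first by rewrite gt_eqF.
  by move=> x; rewrite add0r subr0.
exists (fun x => l *: x), hh; apply: (@le_lt_trans _ _ (l * K)).
  apply: hausdorff_dist_le => _ _ -> [x Ax <-].
  by rewrite eucl_dist0Z gtr0_norm// ler_wpM2l ?AK// ltW.
by rewrite /l mulrAC ltr_pdivrMr// ltr_pM2l// ltrDl.
Qed.

Lemma invariant_continuous_eq (m : nonempty_compact R n -> R) A :
  hausdorff_continuous m -> translation_homothety_invariant m ->
  m A = m nc_origin.
Proof.
move=> mC mI; apply/eqP; rewrite -subr_eq0 -normr_le0.
apply/ler_addgt0Pr => e e0; rewrite add0r.
have [d d0 md] := mC nc_origin e e0.
have [h [hh /md]] := exists_close_rescaling A d0.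
by rewrite mI => /ltW.
Qed.

End Rescaling.

Theorem mainTheorem1 (R : realType) (n : nat) (hn : (1 <= n)%N) :
  ~ exists m : nonempty_compact R n -> R,
      [/\ convexity_measure m,
          hausdorff_continuous m
        & translation_homothety_invariant m].
Proof.
move=> [m [[_ m1 [A_ A_0]] mC mI]].
have mE A : m A = 1%R.
  by rewrite (invariant_continuous_eq A mC mI); apply/m1; exact: convex_set1.
have /funext mA_ : (fun k => m (A_ k)) =1 (fun=> 1%R) by move=> k; exact: mE.
move: A_0; rewrite mA_ => /(cvg_unique (@Rhausdorff R) (cvg_cst _)).
by move/eqP; rewrite oner_eq0.
Qed.
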